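(* Let $q$ be a prime power, let $m\le n$ and $\epsilon$ be positive integers with $m>2\epsilon$, and let $\mathbf{A}\in\mathbb{F}_q^{m\times n}$ with $\mathrm{rank}(\mathbf{A})=m$. Let $\eta=\max_{\mathbf{z}\in\mathcal{I}_{\mathrm{FU}}(\mathbf{A},\epsilon)}\mathrm{wt}(\mathbf{z})$. Then the optimal linear codelength $l_{q,\mathrm{opt}}$ of the $(\mathbf{A},\epsilon)$ function update problem over $\mathbb{F}_q$ satisfies $$l_{q,\mathrm{opt}}\ \le\ m-k_q(m,\eta+1).$$
   Context: Vectors are column vectors and $\mathrm{wt}$ denotes Hamming weight. For the $(\mathbf{A},\epsilon)$ function update problem over $\mathbb{F}_q$, a matrix $\mathbf{H}\in\mathbb{F}_q^{l\times n}$ is called a valid encoder matrix of codelength $l$ if there exists a function $\mathfrak{D}:\mathbb{F}_q^l\times\mathbb{F}_q^m\to\mathbb{F}_q^m$ such that $\mathfrak{D}(\mathbf{H}(\mathbf{x}+\mathbf{e}),\mathbf{A}\mathbf{x})=\mathbf{A}(\mathbf{x}+\mathbf{e})$ for all $\mathbf{x},\mathbf{e}\in\mathbb{F}_q^n$ with $\mathrm{wt}(\mathbf{e})\le\epsilon$. The optimal linear codelength $l_{q,\mathrm{opt}}$ is the minimum $l$ for which a valid encoder matrix $\mathbf{H}\in\mathbb{F}_q^{l\times n}$ exists. Define $\mathcal{I}_{\mathrm{FU}}(\mathbf{A},\epsilon)=\{\mathbf{A}\mathbf{y}\;|\;\mathbf{y}\in\mathbb{F}_q^n,\ 0<\mathrm{wt}(\mathbf{y})\le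 2\epsilon\}\setminus\{\mathbf{0}\}\subseteq\mathbb{F}_q^m$. For integers $N,d\ge 1$, $k_q(N,d)$ denotes the maximum dimension among all linear codes over $\mathbb{F}_q$ of blocklength $N$ and minimum distance at least $d$; the zero code is regarded as having minimum distance $+\infty$, so that $k_q(N,d)=0$ if $d>N$. *)

(* Defs.v *)
(* MathComp world. *)
From HB Require Import structures.
From mathcomp Require Import all_boot all_order all_algebra.

Set Implicit Arguments.
Unset Strict Implicit.
Unset Printing Implicit Defensive.

Import GRing.Theory VectorInternalTheory.
Local Open Scope ring_scope.

(* The library has no finite instance for subspaces over a finite field; this
   one makes the maximum over all linear codes in [max_code_dim] an ordinary
   big operator.  [VectorInternalTheory] is imported only for its subtype
   structure on {vspace vT}. *)
HB.instance Definition _ (F : finFieldType) (vT : vectType F) :=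
  [Countable of {vspace vT} by <:].
HB.instance Definition _ (F : finFieldType) (vT : vectType F) :=
  [Finite of {vspace vT} by <:].

Definition wt (F : finFieldType) (n : nat) (x : 'cV[F]_n) : nat :=
  #|[set i | x i 0 != 0]|.

Definition hamming_dist (F : finFieldType) (n : nat) (x y : 'cV[F]_n) : nat :=
  #|[set i | x i 0 != y i 0]|.

(* Vacuously true for the zero code, whose minimum distance is +oo. *)
Definition min_dist_ge (F : finFieldType) (N : nat) (C : {vspace 'cV[F]_N})
    (d : nat) : bool :=
  [forall x in C, forall y in C, (x != y) ==> (d <= hamming_dist x y)%N].

(* The set of candidate codes is never empty, as it contains 0. *)
Definition max_code_dim (F : finFieldType) (N d : nat) : nat :=
  \max_(C : {vspace 'cV[F]_N} | min_dist_ge C d) \dim C.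

(* Hence the natural-number subtraction N - max_code_dim F N d never truncates. *)
Lemma max_code_dim_le (F : finFieldType) (N d : nat) :
  (max_code_dim F N d <= N)%N.
Proof.
apply/bigmax_leqP => C _; apply: leq_trans (dimvS (subvf C)) _.
by rewrite dimvf /dim /= muln1.
Qed.

(* All spaces are finite, so quantifying over finite functions D means
   quantifying over all functions. *)
Definition valid_encoder (F : finFieldType) (m n : nat) (A : 'M[F]_(m, n))
    (eps l : nat) (H : 'M[F]_(l, n)) : bool :=
  [exists D : {ffun 'cV[F]_l * 'cV[F]_m -> 'cV[F]_m},
    [forall x : 'cV[F]_n, forall e : 'cV[F]_n,
      (wt e <= eps)%N ==> (D (H *m (x + e), A *m x) == A *m (x + e))]].

Lemma valid_encoder_exists (F : finFieldType) (m n : nat) (A : 'M[F]_(m, n))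
    (eps : nat) : exists l : nat, [exists H : 'M[F]_(l, n), valid_encoder A eps H].
Proof.
exists m; apply/existsP; exists A; apply/existsP; exists [ffun p => p.1].
by apply/forallP => x; apply/forallP => e; rewrite ffunE eqxx implybT.
Qed.

Definition opt_codelength (F : finFieldType) (m n : nat) (A : 'M[F]_(m, n))
    (eps : nat) : nat :=
  ex_minn (valid_encoder_exists A eps).

Definition I_FU (F : finFieldType) (m n : nat) (A : 'M[F]_(m, n))
    (eps : nat) : {set 'cV[F]_m} :=
  [set A *m y | y : 'cV[F]_n & (0 < wt y <= 2 * eps)%N] :\ 0.

(* [I_FU A eps] is nonempty as soon as A != 0 and 0 < eps, so the value 0 of
   the empty maximum plays no role under those hypotheses. *)
Definition eta_FU (F : finFieldType) (m n : nat) (A : 'M[F]_(m, n))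
    (eps : nat) : nat :=
  \max_(z in I_FU A eps) wt z.

(* Main.v *)
(* Let C be an optimal code of minimum distance > eta and let P be a
   parity-check matrix of C.  The encoder P *m A is valid: given A x and
   P A (x + e), two candidates for A (x + e) differ by A (e - e'), which lies in
   C and has weight at most eta, hence vanishes. *)
Require Import Defs.
From mathcomp Require Import all_boot all_order all_algebra.

Set Implicit Arguments.
Unset Strict Implicit.
Unset Printing Implicit Defensive.

Import GRing.Theory.
Local Open Scope ring_scope.

(** Put a basis of [C] in the rows of [B]; a row lies in the row space of [B] iff [cokermx B]
    annihilates it. Keeping only a column base of [cokermx B] gives exactly [m - \dim C] parity
    checks, the codelength wanted. *)
Lemma parity_check_exists (F : fieldType) (m : nat) (C : {vspace 'cV[F]_m}) :
  exists P : 'M[F]_(m - \dim C, m), forall v, P *m v = 0 <-> v \in C.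
Proof.
pose B := \matrix_(i < \dim C) ((vbasis C)`_i)^T.
have mulB (u : 'rV_(\dim C)) : (u *m B)^T = \sum_i u 0 i *: (vbasis C)`_i.
  rewrite mulmx_sum_row linear_sum; apply: eq_bigr => i _.
  by rewrite rowK linearZ /= trmxK.
have freeB : row_free B.
  apply: inj_row_free => u uB0; apply/rowP => i; rewrite mxE.
  by move/freeP: (basis_free (vbasisP C)); apply; rewrite -mulB uB0 trmx0.
have -> : (m - \dim C)%N = \rank (cokermx B) by rewrite mxrank_coker (eqP freeB).
exists (col_base (cokermx B))^T => v.
suff PvE : ((col_base (cokermx B))^T *m v == 0) = (v^T <= B)%MS.
  apply: (iff_trans (rwP eqP)); rewrite PvE; split=> [/submxP[u vE] | Cv].
    rewrite -[v]trmxK vE mulB; apply: memv_suml => i _; apply: memvZ.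
    by apply: vbasis_mem; rewrite mem_nth ?size_tuple.
  apply/submxP; exists (\row_i coord (vbasis C) i v).
  apply: trmx_inj; rewrite trmxK mulB [LHS](coord_vbasis Cv).
  by apply: eq_bigr => i _; rewrite mxE.
(* [cokermx B] factors as its column base times its row base; the latter is row free, so it
   cancels. *)
rewrite submxE -[in RHS](mulmx_base (cokermx B)) mulmxA.
rewrite (mulmx_free_eq0 _ (row_base_free _)) -(inj_eq (@trmx_inj _ _ _)).
by rewrite trmx_mul trmxK trmx0.
Qed.

Lemma wt_sub (F : finFieldType) (n : nat) (x y : 'cV[F]_n) :
  (wt (x - y) <= wt x + wt y)%N.
Proof.
apply: leq_trans (leq_card_setU _ _); apply/subset_leq_card/subsetP => i.
rewrite !inE !mxE -negb_and; apply: contra => /andP[/eqP-> /eqP->].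
by rewrite subr0.
Qed.

Lemma wt_eq0 (F : finFieldType) (n : nat) (x : 'cV[F]_n) :
  (wt x == 0%N) = (x == 0).
Proof.
rewrite cards_eq0; apply/eqP/eqP => [x0 | ->]; last first.
  by apply/setP => i; rewrite !inE mxE eqxx.
apply/colP => i; move/setP/(_ i): x0; rewrite !inE mxE.
by move/negbFE/eqP.
Qed.

Lemma hamming_dist0 (F : finFieldType) (n : nat) (x : 'cV[F]_n) :
  hamming_dist x 0 = wt x.
Proof. by apply: eq_card => i; rewrite !inE mxE. Qed.

Lemma min_dist_ge_wt (F : finFieldType) (N d : nat) (C : {vspace 'cV[F]_N}) v :
  min_dist_ge C d -> v \in C -> v != 0 -> (d <= wt v)%N.
Proof.
move=> /'forall_implyP/(_ v) dC Cv; rewrite -hamming_dist0.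
by move/forallP/(_ 0)/implyP/(_ (mem0v C))/implyP: (dC Cv).
Qed.

(** The zero code is admissible for every [d], so the maximum ranges over a nonempty family. *)
Lemma max_code_dim_attained (F : finFieldType) (N d : nat) :
  exists2 C : {vspace 'cV[F]_N}, min_dist_ge C d & \dim C = max_code_dim F N d.
Proof.
have d0 : min_dist_ge (0%VS : {vspace 'cV[F]_N}) d.
  apply/'forall_implyP => x; rewrite memv0 => /eqP->.
  by apply/'forall_implyP => y; rewrite memv0 => /eqP->; rewrite eqxx.
rewrite /max_code_dim (bigmax_eq_arg 0%VS) //.
by case: arg_maxnP => // C dC _; exists C.
Qed.

Lemma wt_le_eta (F : finFieldType) (m n eps : nat) (A : 'M[F]_(m, n)) y :
  (wt y <= 2 * eps)%N -> (wt (A *m y) <= eta_FU A eps)%N.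
Proof.
move=> wty; have [->|Ay0] := eqVneq (A *m y) 0.
  (* The zero vector is excluded from [I_FU], but its weight is below any bound. *)
  by rewrite (eqP (_ : wt 0 == 0)%N) ?wt_eq0.
apply: (leq_bigmax_cond (F := @wt F m)); rewrite !inE Ay0 /=.
apply/imsetP; exists y; rewrite // inE wty andbT lt0n wt_eq0.
by apply: contraNneq Ay0 => ->; rewrite mulmx0.
Qed.

Lemma valid_encoder_mul (F : finFieldType) (m n eps l : nat)
    (A : 'M[F]_(m, n)) (P : 'M[F]_(l, m)) :
    (forall y, (wt y <= 2 * eps)%N -> P *m (A *m y) = 0 -> A *m y = 0) ->
  valid_encoder A eps (P *m A).
Proof.
move=> sepP; pose cand (p : 'cV[F]_l * 'cV[F]_m) (e : 'cV[F]_n) :=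
  (wt e <= eps)%N && (P *m (p.2 + A *m e) == p.1).
(* The decoder adds to the old value [p.2] the update from any sparse error consistent with the
   received [p.1]. The default 0 is never reached on the inputs at issue, as the true error is a
   candidate. *)
pose D := [ffun p => p.2 + (if [pick e | cand p e] is Some e
                            then A *m e else 0)].
apply/existsP; exists D; apply/forallP => x; apply/'forall_implyP => e wte.
rewrite ffunE -mulmxA mulmxDr; case: pickP => [e' | /(_ e)]; last first.
  by rewrite /cand wte eqxx.
rewrite /cand /= => /andP[wte' /eqP PE].
(* The picked [e'] may differ from [e]; separation is applied to [e' - e], whence the factor 2. *)
rewrite (inj_eq (addrI _)) -subr_eq0 -mulmxBr; apply/eqP/sepP.
  by rewrite mul2n -addnn (leq_trans (wt_sub _ _)) ?leq_add.
apply/eqP; rewrite !mulmxBr subr_eq0; move: PE; rewrite !mulmxDr.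
by move=> /addrI ->.
Qed.

Local Close Scope ring_scope.

Theorem theorem5 (F : finFieldType) (m n eps : nat) (A : 'M[F]_(m, n))
    (m_gt0 : 0 < m) (le_mn : m <= n) (eps_gt0 : 0 < eps)
    (m_gt : 2 * eps < m) (rankA : \rank A = m) :
  opt_codelength A eps <= m - max_code_dim F m (eta_FU A eps).+1.
Proof.
have [C distC <-] := max_code_dim_attained F m (eta_FU A eps).+1.
have [P PC] := parity_check_exists C.
(* By minimality of [l], one valid encoder with [m - \dim C] rows suffices. *)
rewrite /opt_codelength; case: ex_minnP => l _; apply.
apply/existsP; exists (P *m A)%R; apply: valid_encoder_mul => y wty /PC Cy.
apply/eqP; apply: contraLR (wt_le_eta A wty) => Ay0.
by rewrite -ltnNge (min_dist_ge_wt distC).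
Qed.
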